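(* Let $n\ge5$. The image of $\phi$ in $\mathbb{P}^1\times\cdots\times\mathbb{P}^{n-3}$ satisfies the $\binom{n-1}{4}$ polynomials given by the $2\times2$ minors of the $2\times(i+1)$ matrices $$\begin{bmatrix} w_0^{(i)}\left(w_0^{(j)}-w_{i+1}^{(j)}\right)& w_1^{(i)}\left(w_1^{(j)}-w_{i+1}^{(j)}\right)&\cdots& w_i^{(i)}\left(w_i^{(j)}-w_{i+1}^{(j)}\right)\\ w_0^{(j)} & w_1^{(j)}&\cdots& w_i^{(j)}\end{bmatrix}$$ for all $1\le i<j\le n-3$. Let $J_n$ be the ideal of $\mathbb{C}[w^{(i)}_j:1\le i\le n-3,\ 0\le j\le i]$ generated by these polynomials. No proper subset of these polynomials forms a basis (generating set) of $J_n$.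
   Context: $\overline{M}_{0,n}$ is the moduli space (over $\mathbb{C}$) of stable $n$-pointed rational curves. For $m\ge4$, $\pi_m:\overline{M}_{0,m}\to\overline{M}_{0,m-1}$ forgets the last marked point and stabilizes, and $\psi_m:\overline{M}_{0,m}\to\mathbb{P}^{m-3}$ is the Kapranov map given by the complete linear system of the line bundle whose fiber is the cotangent line of the curve at $p_m$. The maps $(\pi_m,\psi_m)$ are closed embeddings, and applying them successively gives the closed embedding $\phi:\overline{M}_{0,n}\hookrightarrow\mathbb{P}^1\times\cdots\times\mathbb{P}^{n-3}$. In homogeneous coordinates $w^{(i)}_0,\ldots,w^{(i)}_i$ on the factor $\mathbb{P}^i$, the map $\phi$ is given on the dense open subset $M_{0,n}$ of $n$-tuples $(p_1,\ldots,p_n)$ of distinct points of $\mathbb{P}^1$ (in an affine coordinate) by $$w^{(i)}_j=\frac{p_1-p_{j+2}}{p_{i+3}-p_{j+2}},\qquad 1\le i\le n-3,\ 0\le j\le i.$$ *)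

(* Defs.v *)
From HB Require Import structures.
From mathcomp Require Import all_boot all_order all_algebra.
From mathcomp Require Import complex reals.
From mathcomp Require Import mpoly.

Set Implicit Arguments.
Unset Strict Implicit.
Unset Printing Implicit Defensive.

Import GRing.Theory.
Local Open Scope ring_scope.

(* The complex numbers are R[i] with R a realType.  The factors P^1, ...,
   P^(n-3) are numbered from 0: the index i : 'I_(n - 3) stands for the factor
   P^(i+1), whose homogeneous coordinates are numbered by 'I_i.+2.  In the same
   way the marked points p_1, ..., p_n are the entries p`_0, ..., p`_(n-1) of
   an n-tuple. *)

Definition wvar (n : nat) : finType := {i : 'I_(n - 3) & 'I_i.+2}.

Definition coord (n : nat) (i : 'I_(n - 3)) (k : 'I_i.+2) : wvar n :=
  Tagged (fun i : 'I_(n - 3) => 'I_i.+2) k.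

Notation wpoly R n := {mpoly R[i][#|wvar n|]}.

Section Multiprojective.
Variables (R : realType) (n : nat).

(* Candidate homogeneous coordinates on P^1 x ... x P^(n-3). *)
Definition wcoords := wvar n -> R[i].

Definition weval (f : wpoly R n) (w : wcoords) : R[i] :=
  f.@[fun t => w (enum_val t)].

Definition is_point (w : wcoords) : Prop :=
  forall i : 'I_(n - 3), exists k : 'I_i.+2, w (coord k) != 0.

Definition multihomogeneous (d : 'I_(n - 3) -> nat) (f : wpoly R n) : Prop :=
  forall m, m \in msupp f ->
  forall i : 'I_(n - 3), (\sum_(k < i.+2) m (enum_rank (coord k)))%N = d i.

Definition zariski_closure (S : wcoords -> Prop) (w : wcoords) : Prop :=
  is_point w /\
  forall (d : 'I_(n - 3) -> nat) (f : wpoly R n), multihomogeneous d f ->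
    (forall v, S v -> weval f v = 0) -> weval f w = 0.

Definition phi_open (p : n.-tuple R[i]) : wcoords := fun t =>
  (p`_0 - p`_(tagged t).+1) / (p`_(tag t).+3 - p`_(tagged t).+1).

(* Since M_{0,n} is dense in its compactification and phi is a closed
   embedding, the image of phi is the closure of phi(M_{0,n}). Points are
   given by all their systems of homogeneous coordinates. *)
Definition phi_image : wcoords -> Prop :=
  zariski_closure (fun v => exists2 p : n.-tuple R[i], uniq p & v = phi_open p).

End Multiprojective.

Section Minors.
Variables (R : realType) (n : nat).

(* Only used with k <= i.+1, where inord k is the index k itself. *)
Definition wX (i : 'I_(n - 3)) (k : nat) : wpoly R n :=
  'X_(enum_rank (coord (inord k : 'I_i.+2))).

(* The subtracted coordinate is the first one on the factor j with no
   counterpart on the factor i, whose coordinates are 0, ..., i.+1. *)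
Definition wmx (i j : 'I_(n - 3)) : 'M[wpoly R n]_(2, i.+2) :=
  \matrix_(r < 2, k < i.+2)
    if r == 0 then wX i k * (wX j k - wX j i.+2) else wX j k.

Definition wminor (i j : 'I_(n - 3)) (a b : 'I_i.+2) : wpoly R n :=
  \det (colsub (fun c : 'I_2 => if c == 0 then a else b) (wmx i j)).

Definition wminors : seq (wpoly R n) :=
  flatten
    [seq [seq wminor ij.2 ab.1 ab.2
          | ab : 'I_ij.1.+2 * 'I_ij.1.+2 <- enum predT & (ab.1 < ab.2)%N]
     | ij : 'I_(n - 3) * 'I_(n - 3) <- enum predT & (ij.1 < ij.2)%N].

End Minors.

Definition ideal_gen (A : comPzRingType) (s : seq A) (f : A) : Prop :=
  exists c : 'I_(size s) -> A, f = \sum_(k < size s) c k * s`_k.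

Definition J (R : realType) (n : nat) : wpoly R n -> Prop :=
  ideal_gen (wminors R n).

(* Main.v *)
From mathcomp Require Import all_boot all_order all_algebra.
From mathcomp Require Import complex reals.
From mathcomp Require Import mpoly.
From mathcomp Require Import zify ring.
Require Import Defs.

(** Write w(i,k) for the k-th coordinate on the factor i. Expanding the minor
    of columns a < b of the matrix of i < j gives four cubic monomials,

      w(i,a) w(j,a) w(j,b) - w(i,a) w(j,b) w(j,i+2)
        - w(i,b) w(j,a) w(j,b) + w(i,b) w(j,a) w(j,i+2),

    where i+2 is the column subtracted in the first row of the matrix
    ([wminorE]). Everything is read off this expansion.

    Minimality: the monomial w(i,a) w(j,b) w(j,i+2) has coefficient -1 in this
    minor and 0 in all others ([wminor_mcoeff]), so it marks the minor. Indeed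
    its multidegree (one variable from the factor i, two from j) recovers i
    and j; among the minors of the same i < j, the variable w(j,i+2) singles
    out the second and fourth monomials, as a, b < i+2; and the fourth would
    require a and b exchanged. Since all minors are cubic forms, the degree 3
    part of the ideal that they generate is their linear span: a coefficient
    in degree 3 that vanishes on a set of cubic forms vanishes on the whole
    ideal generated by them ([homog_ideal_coeff]). Hence no minor lies in the
    ideal generated by other minors. The marks also show that the minors are
    pairwise distinct.

    Vanishing: minors are multihomogeneous ([wminor_multihomogeneous]), so by
    the definition of the closure it is enough that they vanish at the image
    of n distinct points, where this is an identity of rational functions
    ([weval_wminor_phi_open]).

    Counting: summing 'C(i+2, 2) over i < j < n-3 gives 'C(n-1, 4) by two
    applications of the hockey-stick identity ([sum_bin]). *)

Set Implicit Arguments.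
Unset Strict Implicit.
Unset Printing Implicit Defensive.

Import GRing.Theory.
Local Open Scope ring_scope.

(** * Counting pairs *)

Lemma sum_ltn_pairs (m : nat) (F : nat -> nat) :
  (\sum_(p : 'I_m * 'I_m | p.1 < p.2) F p.1
     = \sum_(j < m) \sum_(i < j) F i)%N.
Proof.
rewrite -(pair_big_dep predT (fun i j : 'I_m => (i < j)%N) (fun i _ => F i)).
rewrite /= (exchange_big_dep predT) //=; apply: eq_bigr => j _.
exact: (big_ord_narrow (F := fun i : 'I_m => F i) (ltnW (ltn_ord j))).
Qed.

(** The hockey-stick identity; for c <= k the missing lower terms vanish. *)
Lemma sum_bin (c k m : nat) : (c <= k)%N ->
  (\sum_(i < m) 'C(i + c, k) = 'C(m + c, k.+1))%N.
Proof.
move=> le_ck; elim: m => [|m IHm]; first by rewrite big_ord0 bin_small.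
by rewrite big_ord_recr /= IHm addSn binS.
Qed.

Lemma card_ltn_pairs (m : nat) :
  #|[pred p : 'I_m * 'I_m | (p.1 < p.2)%N]| = 'C(m, 2).
Proof.
rewrite -sum1_card (sum_ltn_pairs m (fun=> 1%N)) -bin2_sum big_mkord.
by apply: eq_bigr => j _; rewrite sum1_card card_ord.
Qed.

(** * Ideals generated by forms of one degree *)

Lemma mem_ideal_gen (A : comPzRingType) (s : seq A) (f : A) :
  f \in s -> ideal_gen s f.
Proof.
move=> sf; have lt_f : (index f s < size s)%N by rewrite index_mem.
exists (fun k => (k == Ordinal lt_f)%:R).
rewrite (bigD1 (Ordinal lt_f)) //= eqxx mul1r nth_index // big1 ?addr0 //.
by move=> k /negbTE->; rewrite mul0r.
Qed.

Section HomogeneousGenerators.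
Variables (A : comNzRingType) (m d : nat).

(** Of the products contributing to the coefficient at x, only c@_0 * g@_x
    involves a monomial of g of the right degree. *)
Lemma homog_coeffM (x : 'X_{1..m}) (c g : {mpoly A[m]}) :
  g \is d.-homog -> mdeg x = d -> g@_x = 0 -> (c * g)@_x = 0.
Proof.
move=> g_homog x_deg g_x0; rewrite mcoeffM big1 //= => k /eqP x_sum.
have [k_deg|k_deg] := eqVneq (mdeg k.2) d; last first.
  by rewrite (dhomog_nemf_coeff g_homog k_deg) mulr0.
have x_mdeg : (mdeg x = mdeg k.1 + mdeg k.2)%N by rewrite -mdegD -x_sum.
have k10 : (k.1 : 'X_{1..m}) = 0%MM by apply/eqP; rewrite -mdeg_eq0; lia.
suff -> : g@_k.2 = 0 by rewrite mulr0.
by rewrite -g_x0 [in RHS]x_sum k10 add0m.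
Qed.

(** In the degree d of the generators, the ideal is no larger than their
    linear span; so a linear form on that degree, here a coefficient, can
    separate a polynomial from the ideal. *)
Lemma homog_ideal_coeff (x : 'X_{1..m}) (S : seq {mpoly A[m]}) :
  mdeg x = d -> {in S, forall g, g \is d.-homog /\ g@_x = 0} ->
  forall f, ideal_gen S f -> f@_x = 0.
Proof.
move=> x_deg S_x f [c ->]; rewrite raddf_sum big1 //= => k _.
have [g_homog g_x0] := S_x _ (mem_nth 0 (ltn_ord k)).
exact: homog_coeffM g_homog x_deg g_x0.
Qed.

End HomogeneousGenerators.

(** * The monomials of a minor *)

Section MinorMonomials.
Variables (R : realType) (n : nat).
Implicit Types (i j : 'I_(n - 3)) (t : wvar n).

(** Natural numbers as second index let one column number be used on both
    factors i and j of a minor; it is meaningful for k < i.+2. *)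
Definition wcoord i (k : nat) : wvar n := coord (inord k : 'I_i.+2).

Definition wmon t1 t2 t3 : 'X_{1..#|wvar n|} :=
  (U_(enum_rank t1) + U_(enum_rank t2) + U_(enum_rank t3))%MM.

Lemma wcoord_eq i i' (k k' : nat) : (k < i.+2)%N -> (k' < i'.+2)%N ->
  (wcoord i k == wcoord i' k') = (i == i') && (k == k').
Proof.
move=> lt_k lt_k'; have [eq_i|/negbTE ne_i] := eqVneq i i'; last first.
  by apply/negbTE/eqP => /(congr1 tag) /= /eqP; rewrite ne_i.
subst i'; rewrite /wcoord /coord eq_Tagged /= -val_eqE /= !inordK //.
Qed.

Lemma coord_wcoord i (k : 'I_i.+2) : coord k = wcoord i k.
Proof. by rewrite /wcoord inord_val. Qed.

Lemma wmonE t1 t2 t3 t :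
  wmon t1 t2 t3 (enum_rank t) = ((t1 == t) + (t2 == t) + (t3 == t))%N.
Proof. by rewrite !mnmDE !mnm1E !(inj_eq enum_rank_inj). Qed.

Lemma mdeg_wmon t1 t2 t3 : mdeg (wmon t1 t2 t3) = 3.
Proof. by rewrite !mdegD !mdeg1. Qed.

Lemma mpolyX_wmon t1 t2 t3 :
  'X_[wmon t1 t2 t3] =
    'X_(enum_rank t1) * 'X_(enum_rank t2) * 'X_(enum_rank t3) :> wpoly R n.
Proof. by rewrite !mpolyXD. Qed.

Lemma sum_tag t i : (\sum_(k < i.+2) (t == coord k) = (tag t == i))%N.
Proof.
case: t => i' k'; rewrite -[existT _ _ _]/(coord k') /=.
under eq_bigr do rewrite !coord_wcoord wcoord_eq //.
have [eq_i|ne_i] := eqVneq i' i; last by rewrite big1.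
subst i'; rewrite (bigD1 k') //= eqxx big1 // => k.
by rewrite -val_eqE eq_sym => /negbTE->.
Qed.

Lemma multideg_wmon t1 t2 t3 i :
  (\sum_(k < i.+2) wmon t1 t2 t3 (enum_rank (coord k))
     = (tag t1 == i) + (tag t2 == i) + (tag t3 == i))%N.
Proof.
under eq_bigr do rewrite wmonE.
by rewrite !big_split /= !sum_tag.
Qed.

Lemma wminorE i j (a b : 'I_i.+2) :
  wminor R j a b =
    'X_[wmon (wcoord i a) (wcoord j a) (wcoord j b)]
    - 'X_[wmon (wcoord i a) (wcoord j b) (wcoord j i.+2)]
    - 'X_[wmon (wcoord i b) (wcoord j a) (wcoord j b)]
    + 'X_[wmon (wcoord i b) (wcoord j a) (wcoord j i.+2)].
Proof.
rewrite /wminor (expand_det_row _ ord0).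
rewrite !big_ord_recl big_ord0 /cofactor !det_mx11 !mxE /=.
rewrite /wX !mpolyX_wmon /wcoord /bump /= !addn0 expr0 expr1; ring.
Qed.

(** The monomial of the minor of i, j, a, b that occurs in no other minor: the
    second one in [wminorE]. *)
Definition wminor_mark i j (a b : nat) : 'X_{1..#|wvar n|} :=
  wmon (wcoord i a) (wcoord j b) (wcoord j i.+2).

(** The multidegree has value 1 at i and 2 at j, which tells i and j apart. *)
Lemma wmon_index_inj i j i' j' (k l h k' l' h' : nat) : (i < j)%N ->
  wmon (wcoord i' k') (wcoord j' l') (wcoord j' h')
    = wmon (wcoord i k) (wcoord j l) (wcoord j h) ->
  i' = i /\ j' = j.
Proof.
move=> lt_ij eq_mon.
have deg (g : 'I_(n - 3)) : ((i' == g) + (j' == g) + (j' == g)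
    = (i == g) + (j == g) + (j == g))%N.
  have := congr1 (fun m : 'X_{1..#|wvar n|} =>
    (\sum_(l < g.+2) m (enum_rank (coord l)))%N) eq_mon.
  by rewrite /= !multideg_wmon.
have := deg i; have := deg j; rewrite -!val_eqE /= => deg_j deg_i.
by split; apply: val_inj => /=; lia.
Qed.

(** The mark is divisible by the coordinate i.+2 of the factor j, which is
    beyond the columns of the matrix of i and j. *)
Lemma wmon_low_neq_mark i j (k l h a b : nat) : (i < j)%N ->
  (k < i.+2)%N -> (l < i.+2)%N -> (h < i.+2)%N ->
  (a < i.+2)%N -> (b < i.+2)%N ->
  (wmon (wcoord i k) (wcoord j l) (wcoord j h) == wminor_mark i j a b) = false.
Proof.
move=> lt_ij lt_k lt_l lt_h lt_a lt_b; apply/eqP.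
move/(congr1 (fun m : 'X_{1..#|wvar n|} => m (enum_rank (wcoord j i.+2)))).
rewrite /= !wmonE eqxx !wcoord_eq //; lia.
Qed.

Lemma wminor_mark_eq i j (k l a b : nat) : (i < j)%N ->
  (k < i.+2)%N -> (l < i.+2)%N -> (a < i.+2)%N -> (b < i.+2)%N ->
  (wminor_mark i j k l == wminor_mark i j a b) = (k == a) && (l == b).
Proof.
move=> lt_ij lt_k lt_l lt_a lt_b.
apply/eqP/idP => [eq_mon|/andP[/eqP-> /eqP->] //].
have at_coord t : wminor_mark i j k l (enum_rank t)
    = wminor_mark i j a b (enum_rank t) by rewrite eq_mon.
have := at_coord (wcoord i a); have := at_coord (wcoord j b).
rewrite !wmonE !wcoord_eq //; try lia.
by rewrite !eqxx -!val_eqE /=; lia.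
Qed.

(** The matrix of coefficients of the minors at the marks is minus the
    identity; this gives both distinctness and minimality. *)
Lemma wminor_mcoeff i j i' j' (a b : 'I_i.+2) (a' b' : 'I_i'.+2) :
  (i < j)%N -> (i' < j')%N -> (a < b)%N -> (a' < b')%N ->
  (wminor R j' a' b')@_(wminor_mark i j a b) =
    - ([&& i' == i, j' == j, a' == a :> nat & b' == b :> nat])%:R.
Proof.
move=> lt_ij lt_ij' lt_ab lt_ab'.
rewrite wminorE !(mcoeffD, mcoeffN) !mcoeffX -!/(wminor_mark _ _ _ _).
have [/andP[/eqP ei /eqP ej]|ne_ij] := boolP ((i' == i) && (j' == j)).
  subst i' j'; rewrite !eqxx /= !wminor_mark_eq ?wmon_low_neq_mark //.
  (* The fourth monomial is the mark of the exchanged columns b', a'. *)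
  have -> : (b' == a :> nat) && (a' == b :> nat) = false by lia.
  by rewrite oppr0 !addr0 add0r.
have mon_neq k l h : (wmon (wcoord i' k) (wcoord j' l) (wcoord j' h)
    == wminor_mark i j a b) = false.
  by apply: contraNF ne_ij => /eqP/(wmon_index_inj lt_ij)[-> ->]; rewrite !eqxx.
by rewrite andbA (negbTE ne_ij) !mon_neq !oppr0 !addr0.
Qed.

Lemma wminor_index_inj i j i' j' (a b : 'I_i.+2) (a' b' : 'I_i'.+2) :
  (i < j)%N -> (i' < j')%N -> (a < b)%N -> (a' < b')%N ->
  wminor R j' a' b' = wminor R j a b ->
  [&& i' == i, j' == j, a' == a :> nat & b' == b :> nat].
Proof.
move=> lt_ij lt_ij' lt_ab lt_ab' eq_f.
have := wminor_mcoeff lt_ij lt_ij' lt_ab lt_ab'.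
rewrite eq_f wminor_mcoeff // !eqxx /= => /oppr_inj /eqP.
by case: [&& _, _, _ & _]; rewrite // oner_eq0.
Qed.

Lemma wminor_dhomog i j (a b : 'I_i.+2) : wminor R j a b \is 3.-homog.
Proof.
rewrite wminorE.
have X_homog t1 t2 t3 : ('X_[wmon t1 t2 t3] : wpoly R n) \is 3.-homog.
  by rewrite dhomogX /= mdeg_wmon.
by rewrite rpredD ?rpredB ?X_homog.
Qed.

Lemma wminor_multihomogeneous i j (a b : 'I_i.+2) :
  multihomogeneous (fun k => (i == k) + (j == k) * 2)%N (wminor R j a b).
Proof.
move=> m; rewrite mcoeff_msupp wminorE !(mcoeffD, mcoeffN) !mcoeffX => m_supp k.
have : [|| wmon (wcoord i a) (wcoord j a) (wcoord j b) == m,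
  wmon (wcoord i a) (wcoord j b) (wcoord j i.+2) == m,
  wmon (wcoord i b) (wcoord j a) (wcoord j b) == m |
  wmon (wcoord i b) (wcoord j a) (wcoord j i.+2) == m].
  by apply: contraNT m_supp => /norP[/negbTE-> /norP[/negbTE-> /norP[
     /negbTE-> /negbTE->]]]; rewrite !oppr0 !addr0.
by case/or4P => /eqP<-; rewrite multideg_wmon /= -addnA addnn muln2.
Qed.

(** At the image of p, w(i,k) is (p_0 - p_(k+1)) / (p_(i+3) - p_(k+1)), and
    in each column k the first entry is the second one times
    (p_(j+3) - p_0) / (p_(j+3) - p_(i+3)), which does not depend on k. *)
Lemma weval_wminor_phi_open i j (a b : 'I_i.+2) (p : n.-tuple R[i]) :
  (i < j)%N -> uniq p -> weval (wminor R j a b) (phi_open p) = 0.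
Proof.
move=> lt_ij Up.
have nz (k l : nat) : (l < k)%N -> (k < n)%N -> p`_k - p`_l != 0.
  move=> lt_lk lt_kn; rewrite subr_eq0 nth_uniq ?size_tuple //; lia.
have la := ltn_ord a; have lb := ltn_ord b; have lj := ltn_ord j.
rewrite /weval wminorE !(mevalD, mevalB, mevalN) !mpolyX_wmon !mevalM !mevalXU.
rewrite !enum_rankK /phi_open /wcoord /coord /= !inordK; try lia.
field; rewrite !nz; lia.
Qed.

(** * The family of all minors *)

Lemma wminorsP (f : wpoly R n) : f \in wminors R n ->
  exists i j (a b : 'I_i.+2), [/\ (i < j)%N, (a < b)%N & f = wminor R j a b].
Proof.
case/allpairsPdep => -[i j] [[a b] []].
rewrite !mem_filter /= => /andP[lt_ij _] /andP[lt_ab _] ->.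
by exists i, j, a, b.
Qed.

Lemma uniq_wminors : uniq (wminors R n).
Proof.
apply: allpairs_uniq_dep => [|ij _|]; try exact: filter_uniq (enum_uniq _).
move=> _ _ /allpairsPdep[[i j] [[a b] [s_ij s_ab ->]]]
  /allpairsPdep[[i' j'] [[a' b'] [s_ij' s_ab' ->]]].
move: s_ij s_ab s_ij' s_ab'; rewrite !mem_filter.
move=> /andP[lt_ij _] /andP[lt_ab _] /andP[lt_ij' _] /andP[lt_ab' _].
move=> /esym/(wminor_index_inj lt_ij lt_ij' lt_ab lt_ab').
case/and4P => /= /eqP ei /eqP ej /eqP ea /eqP eb.
move: a a' b b' ea eb {lt_ab lt_ab'}.
rewrite /= => a a' b b'; subst i' j'.
by move=> /val_inj-> /val_inj->.
Qed.

Lemma size_wminors : size (wminors R n) = 'C(n - 3 + 2, 4).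
Proof.
rewrite size_allpairs_dep sumnE big_map big_filter big_enum_cond /=.
transitivity (\sum_(p : 'I_(n - 3) * 'I_(n - 3) | p.1 < p.2) 'C(p.1 + 2, 2))%N.
  apply: eq_bigr => p _.
  by rewrite addn2 -card_ltn_pairs cardE /enum_mem filter_predT.
rewrite (sum_ltn_pairs _ (fun i : nat => 'C(i + 2, 2))%N).
under eq_bigr do rewrite sum_bin //.
exact: sum_bin.
Qed.

End MinorMonomials.

Theorem lemma4p1 (R : realType) (n : nat) (hn : (5 <= n)%N) :
  [/\ uniq (wminors R n),
      size (wminors R n) = 'C(n - 1, 4),
      (forall (x : wcoords R n) (f : wpoly R n),
         phi_image x -> f \in wminors R n -> weval f x = 0)
    & (forall S : seq (wpoly R n),
         {subset S <= wminors R n} -> ~ {subset wminors R n <= S} ->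
         ~ (forall f : wpoly R n, ideal_gen S f <-> J f))].
Proof.
split.
- exact: uniq_wminors.
- by rewrite size_wminors; congr 'C(_, _); lia.
- move=> x f [_ x_closed] /wminorsP[i [j [a [b [lt_ij _ ->]]]]].
  (* The vanishing of f is a closed condition: test it on the open part. *)
  apply: (x_closed _ _ (@wminor_multihomogeneous R n i j a b)) => v [p Up ->].
  exact: weval_wminor_phi_open.
move=> S sSW nsWS S_gen.
have /allPn[f Wf S'f] : ~~ all (mem S) (wminors R n) by apply/negP => /allP.
have [i [j [a [b [lt_ij lt_ab def_f]]]]] := wminorsP Wf.
(* If S generated J, then f would lie in the ideal of S; compare coefficients
   at the mark of f. *)
have := (S_gen f).2 (mem_ideal_gen Wf).
move/(homog_ideal_coeff (mdeg_wmon _ _ _ : mdeg (wminor_mark i j a b) = 3)).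
rewrite {1}def_f wminor_mcoeff // !eqxx /= => f0.
suff /f0/eqP : {in S, forall g : wpoly R n, g \is 3.-homog /\
    g@_(wminor_mark i j a b) = 0} by rewrite oppr_eq0 oner_eq0.
move=> g Sg.
have [i' [j' [a' [b' [lt_ij' lt_ab' def_g]]]]] := wminorsP (sSW g Sg).
split; first by rewrite def_g wminor_dhomog.
rewrite def_g wminor_mcoeff //.
case: and4P => [[/eqP ei /eqP ej /eqP ea /eqP eb]|_]; last by rewrite oppr0.
case/negP: S'f; subst i' j'.
by rewrite def_f -(val_inj ea) -(val_inj eb) -def_g.
Qed.
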